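(* Let $S\subset\mathbb{R}^n$ be a nonempty semi-algebraic set, $f\colon\mathbb{R}^n\to\mathbb{R}\cup\{\infty\}$ a semi-algebraic function such that $f_* := \inf_{x\in S} f(x)$ is finite, and $\psi\colon\mathbb{R}^n\to\mathbb{R}_+$ a semi-algebraic residual function for $S$. The following properties are equivalent: (i) there exist constants $c_*>0$, $\alpha>0$ and $\beta>0$ with $\alpha\le1\le\beta$ such that for all $c>c_*$, $$\inf_{x\in S} f(x)=\inf_{x\in\mathbb{R}^n}\left\{f(x)+c\left([\psi(x)]^\alpha+[\psi(x)]^\beta\right)\right\};$$ (ii) there exist constants $c_*>0$, $\alpha>0$ and $\beta>0$ with $\alpha\le1\le\beta$ such that $$c_*\left([\psi(x)]^\alpha+[\psi(x)]^\beta\right)\ge[f_*-f(x)]_+\quad\text{for all } x\in\mathbb{R}^n;$$ (iii) for any sequence of points $x_k$ in $\mathbb{R}^n$ one has: (iii1) if $\psi(x_k)\to0$, then $[f_*-f(x_k)]_+\to0$; and (iii2) if $f(x_k)\to-\infty$, then $\psi(x_k)\to\infty$. When these equivalent properties hold, one has moreover (with $c_*,\alpha,\beta$ as in (i) or (ii)) for all $c>c_*$ that $$\mathrm{argmin}_S f(x)=\mathrm{argmin}_{\mathbb{R}^n}\left\{f(x)+c\left([\psi(x)]^\alpha+[\psi(x)]^\beta\right)\right\}.$$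
   Context: $\mathbb{R}_+ := [0,\infty)$ and $[r]_+ := \max\{r,0\}$ (with $[f_*-f(x)]_+=0$ if $f(x)=\infty$). A subset of $\mathbb{R}^n$ is semi-algebraic if it is a finite union of sets each defined by finitely many polynomial equations and strict inequalities; a function $h\colon X\to\mathbb{R}\cup\{\infty\}$ is semi-algebraic if $\{(x,y)\in X\times\mathbb{R}\mid y=h(x)\}$ is semi-algebraic. A residual function of $S$ is a function $\psi\colon\mathbb{R}^n\to\mathbb{R}_+$ such that $\psi(x)=0$ if and only if $x\in S$. No continuity of $f$ or $\psi$ and no closedness of $S$ is assumed. $\mathrm{argmin}$ denotes the set of points of the indicated set at which the (finite) infimum is attained (possibly empty). *)

(* Defs.v *)
From HB Require Import structures.
From mathcomp Require Import all_boot all_order all_algebra.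
From mathcomp Require Import all_classical all_reals all_analysis.
(* The notations of [mpoly] clash with those of MathComp-Analysis. *)
From mathcomp Require Import -(notations) mpoly.

Set Implicit Arguments.
Unset Strict Implicit.
Unset Printing Implicit Defensive.

Import Order.TTheory GRing.Theory Num.Theory.
Import numFieldNormedType.Exports.

Local Open Scope classical_set_scope.
Local Open Scope ring_scope.

Definition basic_semialgebraic (R : realType) (n : nat)
    (E I : seq (mpoly n R)) : set 'rV[R]_n :=
  [set x : 'rV[R]_n |
    (forall p : mpoly n R, p \in E -> meval (x 0) p = 0) /\
    (forall q : mpoly n R, q \in I -> 0 < meval (x 0) q)].

Definition semialgebraic (R : realType) (n : nat) (A : set 'rV[R]_n) : Prop :=
  exists s : seq (seq (mpoly n R) * seq (mpoly n R)),
    A = \bigcup_(B in [set` s]) basic_semialgebraic B.1 B.2.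

(* The graph lies in R^n x R, so points with an infinite value are left out. *)
Definition semialgebraic_fun (R : realType) (n : nat)
    (h : 'rV[R]_n -> \bar R) : Prop :=
  semialgebraic [set z : 'rV[R]_(n + 1) | (rsubmx z 0 0)%:E = h (lsubmx z)].

Definition residual_function (R : realType) (n : nat) (S : set 'rV[R]_n)
    (psi : 'rV[R]_n -> R) : Prop :=
  (forall x, 0 <= psi x) /\ (forall x, psi x = 0 <-> S x).

Definition inf_on (R : realType) (T : Type) (A : set T) (g : T -> \bar R) :
    \bar R :=
  ereal_inf (g @` A).

Definition argmin (R : realType) (T : Type) (A : set T) (g : T -> \bar R) :
    set T :=
  [set x | [/\ A x, inf_on A g \is a fin_num & g x = inf_on A g]].

(* When [f x = +oo] the difference is [-oo] ([fstar] being finite), and the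
   positive part is 0. *)
Definition pos_gap (R : realType) (T : Type) (fstar : \bar R) (f : T -> \bar R)
    (x : T) : \bar R :=
  Order.max (fstar - f x)%E 0%E.

Definition penalty (R : realType) (T : Type) (psi : T -> R) (alpha beta : R)
    (x : T) : R :=
  psi x `^ alpha + psi x `^ beta.

Definition penalized (R : realType) (T : Type) (f : T -> \bar R) (psi : T -> R)
    (alpha beta c : R) (x : T) : \bar R :=
  (f x + (c * penalty psi alpha beta x)%:E)%E.

Definition admissible (R : realType) (cstar alpha beta : R) : Prop :=
  [/\ 0 < cstar, 0 < alpha, 0 < beta & alpha <= 1 <= beta].

Definition exact_penalty (R : realType) (T : Type) (S : set T)
    (f : T -> \bar R) (psi : T -> R) (cstar alpha beta : R) : Prop :=
  forall c : R, cstar < c ->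
    inf_on S f = inf_on setT (penalized f psi alpha beta c).

Definition global_error_bound (R : realType) (T : Type) (S : set T)
    (f : T -> \bar R) (psi : T -> R) (cstar alpha beta : R) : Prop :=
  forall x : T,
    (pos_gap (inf_on S f) f x <= (cstar * penalty psi alpha beta x)%:E)%E.

Definition sequential_condition (R : realType) (T : Type) (S : set T)
    (f : T -> \bar R) (psi : T -> R) : Prop :=
  forall x : nat -> T,
    (psi (x k) @[k --> \oo] --> 0 ->
       pos_gap (inf_on S f) f (x k) @[k --> \oo] --> 0%E) /\
    (f (x k) @[k --> \oo] --> -oo%E ->
       psi (x k) @[k --> \oo] --> +oo).

(* Main.v *)
Require Import Defs.
From HB Require Import structures.
From mathcomp Require Import all_boot all_order all_algebra.
From mathcomp Require Import all_classical all_reals all_analysis.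
From mathcomp Require Import polyXY lra.
From mathcomp Require Import -(notations) mpoly.
From mathcomp Require ordered_qelim qe_rcf polyrcf.

Set Implicit Arguments.
Unset Strict Implicit.
Unset Printing Implicit Defensive.

Import Order.TTheory GRing.Theory Num.Theory.
Import numFieldNormedType.Exports.

Local Open Scope classical_set_scope.
Local Open Scope ring_scope.

(** Write [a] for the infimum of [f] over [S].  The equivalence of (i) and (ii),
    with the same constants, and the statement on minimizers are elementary:
    for nonnegative constants the error bound (ii) says that [a] is a lower
    bound of the penalized function, and the penalty vanishes exactly on [S].
    That (ii) implies (iii) is a squeeze.

    The content is that (iii) implies (ii).  For [t > 0] put
    [D t = {y | exists x, psi x <= t /\ f x <= a - y}] and [g t = sup (D t)],
    the worst gap at residual level [t].  By (iii), [g t] is finite for every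
    [t] and its positive part tends to [0] with [t]; what has to be found is a
    power of [t] that dominates [g t] near [0], and one that dominates it near
    infinity (between the two, [g] is bounded).

    The set of pairs [(t, y)] with [y] in [D t] is the projection of a
    semi-algebraic set, so quantifier elimination over real closed fields yields
    finitely many polynomials in [(t, y)] whose signs decide membership
    ([sublevel_formula], [holds_same_signs]).  Since membership changes at
    [y = g t], one of these polynomials, not identically zero in [y], vanishes
    at [(t, g t)] ([sup_root]).  It then suffices to bound the roots [y] of one
    nonzero bivariate polynomial [P]:
    - for large [t], the leading coefficient of [P] in [y] stays away from zero
      and the Cauchy root bound is polynomial in [t] ([root_growth]);
    - near the origin, once the powers of [t] are divided out, [P (0, y)] is
      [y ^ e] times a factor that does not vanish at [0], while
      [P (t, y) - P (0, y)] is [O(t)]; hence [y ^ e = O(t)] ([root_decay]).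
    In both cases one integer [k] serves as exponent, as threshold and to absorb
    the constants, which lets finitely many bounds be merged by taking [k]
    large ([uniform_threshold]).  The exponents of (ii) are
    [alpha = 1 / k] and [beta = k] ([semialgebraic_error_bound]). *)

(** * Roots of bivariate polynomials near infinity and near the origin *)

Lemma horner2E (R : comNzRingType) (P : {poly {poly R}}) (x y : R) :
  P.[x, y] = (map_poly (horner_eval y) P).[x].
Proof. by rewrite -horner2_swapXY horner_swapXY. Qed.

Lemma ler_norm_horner (R : realFieldType) (p : {poly R}) (M x : R) (n : nat) :
  1 <= M -> `|x| <= M -> (size p <= n)%N ->
  `|p.[x]| <= (\sum_(i < size p) `|p`_i|) * M ^+ n.
Proof.
move=> M1 xM pn; rewrite horner_coef mulr_suml.
apply: (le_trans (ler_norm_sum _ _ _)); apply: ler_sum => i _.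
rewrite normrM ler_wpM2l// normrX (le_trans (lerXn2r _ _ _ xM)) ?nnegrE//.
  by rewrite (le_trans _ M1).
by rewrite ler_weXn2l// (leq_trans _ pn)// ltnW.
Qed.

(** Choosing the exponent larger than the sum of the coefficients as well as
    the degree leaves no multiplicative constant. *)
Lemma poly_growth (R : archiRealFieldType) (p : {poly R}) :
  exists K : nat, forall k, (K <= k)%N -> forall t : R, k%:R <= t ->
    `|p.[t]| <= t ^+ k.
Proof.
set s := \sum_(i < size p) `|p`_i|.
exists (maxn (size p).+1 (Num.bound s)) => k.
rewrite geq_max => /andP[sk bk] t kt.
have t1 : 1 <= t by rewrite (le_trans _ kt)// ler1n (leq_trans _ sk).
have t0 : 0 <= t by rewrite (le_trans _ t1).
have st : s <= t.
  apply: ltW; apply: lt_le_trans kt.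
  rewrite (lt_le_trans (archi_boundP _))//; first exact: sumr_ge0.
  by rewrite ler_nat.
have tn : `|t| <= t by rewrite ger0_norm.
apply: (le_trans (ler_norm_horner t1 tn (leqnn _))).
apply: (@le_trans _ _ (t ^+ (size p).+1)); last by rewrite ler_weXn2l.
by rewrite exprS ler_wpM2r// exprn_ge0.
Qed.

Lemma poly_bounded_below (R : archiRealFieldType) (p : {poly R}) : p != 0 ->
  exists2 c : R, 0 < c &
    exists K : nat, forall t : R, K%:R <= t -> c <= `|p.[t]|.
Proof.
move=> p0; wlog lp : p p0 / 0 < lead_coef p.
  move=> H; have := lead_coef_eq0 p; rewrite (negbTE p0) => /negbT.
  rewrite neq_lt => /orP[l0|]; last exact: H.
  have [||c c0 [K HK]] := H (- p); rewrite ?oppr_eq0 ?lead_coefN ?oppr_gt0//.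
  by exists c => //; exists K => t /HK; rewrite hornerN normrN.
have [n Hn] := polyrcf.poly_pinfty_gt_lc lp.
exists (lead_coef p) => //; exists (Num.bound `|n|) => t nt.
rewrite (le_trans _ (ler_norm _))// Hn// (le_trans _ nt)//.
by rewrite (le_trans (ler_norm _))// ltW// archi_boundP.
Qed.

(** For large [t] the leading coefficient of [P] in [y] is bounded away from
    zero, so Cauchy's bound on the roots of [P (t, .)] is itself bounded by a
    polynomial in [t]. *)
Lemma root_growth (R : archiRealFieldType) (P : {poly {poly R}}) : P != 0 ->
  exists K : nat, forall k, (K <= k)%N -> forall t y : R, k%:R <= t ->
    P.[y, t] = 0 -> `|y| <= t ^+ k.
Proof.
move=> P0; have [|c c0 [K1 HK1]] := @poly_bounded_below _ (lead_coef P).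
  by rewrite lead_coef_eq0.
pose q := 1 + c^-1 *: \sum_(i < size P) map_poly Num.norm P`_i.
have [K2 HK2] := poly_growth q.
exists (maxn K1 K2) => k; rewrite geq_max => /andP[K1k K2k] t y kt.
have t0 : 0 <= t by rewrite (le_trans _ kt).
have lc : c <= `|(lead_coef P).[t]|.
  by apply: HK1; rewrite (le_trans _ kt)// ler_nat.
have lc0 : (lead_coef P).[t] != 0 by rewrite -normr_gt0 (lt_le_trans c0).
have sz : size (map_poly (horner_eval t) P) = size P by apply: size_map_poly_id0.
have Q0 : map_poly (horner_eval t) P != 0.
  by rewrite -size_poly_gt0 sz size_poly_gt0.
rewrite horner2E => /(polyrcf.cauchy_boundP Q0)/ltW/le_trans; apply.
apply: le_trans (HK2 _ K2k _ kt); apply: le_trans (ler_norm _).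
rewrite /polyrcf.cauchy_bound lead_coef_map_eq// sz /q hornerD hornerC lerD2l.
rewrite hornerZ horner_sum; apply: ler_pM.
- by rewrite invr_ge0.
- exact: sumr_ge0.
- by rewrite lef_pV2// posrE normr_gt0.
apply: ler_sum => i _; rewrite coef_map /= /horner_eval.
rewrite [in leRHS]/map_poly horner_poly horner_coef.
apply: (le_trans (ler_norm_sum _ _ _)); apply: ler_sum => j _.
by rewrite normrM normrX (ger0_norm t0).
Qed.

(** Write [P = t ^ m * Q] with [Q (0, y)] nonzero and [Q (0, y) = y ^ e * u y]
    with [u 0 != 0].  On a root with [t > 0] this gives
    [u y * y ^ e = - t * r (t, y)], hence [|y| ^ e <= C t]; the extra factor
    [|y| <= 1 / k] absorbs [C]. *)
Lemma root_decay (R : archiRealFieldType) (P : {poly {poly R}}) : P != 0 ->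
  exists K : nat, forall k, (K <= k)%N -> forall t y : R,
    0 < t <= k%:R^-1 -> `|y| <= k%:R^-1 -> P.[t, y] = 0 -> `|y| ^+ k <= t.
Proof.
move=> P0; have [m [Q]] := multiplicity_XsubC P 0.
rewrite P0 /= subr0 => nQ PE.
have q0 : Q.[0] != 0 by [].
have [e [u]] := multiplicity_XsubC Q.[0] 0.
rewrite q0 /= subr0 => nu QE.
have /factor_theorem[r rE] : root (Q - Q.[0]%:P) 0.
  by rewrite rootE hornerD hornerN hornerC subrr.
have /factor_theorem[w wE] : root (u - u.[0]%:P) 0.
  by rewrite rootE hornerD hornerN hornerC subrr.
pose A : R := \sum_(i < size w) `|w`_i|.
pose B : R := \sum_(i < size r) \sum_(j < size r`_i) `|(r`_i)`_j|.
pose c := `|u.[0]| / 2.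
have c0 : 0 < c by rewrite divr_gt0// normr_gt0.
exists (maxn e.+1 (maxn (Num.bound (A / c)) (Num.bound (B / c)))) => k.
rewrite !geq_max => /and3P[ek Ak Bk] t y /andP[t0 tk] yk.
have k0 : (0 < k)%N by rewrite (leq_trans _ ek).
have k0R : 0 < k%:R :> R by rewrite ltr0n.
have kV1 : k%:R^-1 <= 1 :> R by rewrite invf_le1// ler1n.
have y1 : `|y| <= 1 by rewrite (le_trans yk).
have t1 : `|t| <= 1 by rewrite gtr0_norm// (le_trans tk).
have A0 : 0 <= A by apply: sumr_ge0.
have B0 : 0 <= B by apply: sumr_ge0 => i _; apply: sumr_ge0.
have bk (C : R) : 0 <= C -> (Num.bound (C / c) <= k)%N -> C <= c * k%:R.
  move=> C0 Ck; rewrite mulrC -ler_pdivrMr// ltW//.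
  by rewrite (lt_le_trans (archi_boundP _)) ?ler_nat// divr_ge0// ltW.
have {}Ak := bk _ A0 Ak; have {}Bk := bk _ B0 Bk.
have QtE : Q.[t, y] = r.[t, y] * t + u.[y] * y ^+ e.
  have -> : Q = r * 'X + Q.[0]%:P by rewrite -[LHS](subrK Q.[0]%:P) rE subr0.
  by rewrite QE !hornerE.
have uyE : u.[y] = w.[y] * y + u.[0].
  by rewrite -{1}[u](subrK u.[0]%:P) wE !hornerE subr0.
have rB : `|r.[t, y]| <= B.
  rewrite (horner_coef r) horner_sum (le_trans (ler_norm_sum _ _ _))//.
  apply: ler_sum => i _; rewrite !hornerE normrM.
  rewrite -[leRHS]mulr1 ler_pM//; last by rewrite normrX exprn_ile1.
  by have := ler_norm_horner (lexx 1) y1 (leqnn (size r`_i)); rewrite expr1n mulr1.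
have wA : `|w.[y]| <= A.
  by have := ler_norm_horner (lexx 1) y1 (leqnn (size w)); rewrite expr1n mulr1.
have uc : c <= `|u.[y]|.
  have wyc : `|w.[y] * y| <= c.
    by rewrite normrM (le_trans (ler_pM _ _ wA yk))// ler_pdivrMr.
  have u0E : u.[0] = u.[y] - w.[y] * y by rewrite uyE addrAC subrr add0r.
  have := ler_normB u.[y] (w.[y] * y).
  by rewrite -u0E [`|u.[0]|]splitr -/c; lra.
rewrite PE hornerM hornerM horner_exp hornerX horner_exp hornerC => /eqP.
rewrite mulf_eq0 expf_eq0 (gt_eqF t0) andbF orbF QtE addr_eq0 => /eqP Eq.
have ce : c * `|y| ^+ e <= B * t.
  rewrite (@le_trans _ _ (`|u.[y]| * `|y| ^+ e))//.
    by rewrite ler_wpM2r// exprn_ge0.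
  rewrite -normrX -normrM -normrN -Eq normrM (gtr0_norm t0).
  by rewrite ler_wpM2r// ltW.
apply: (@le_trans _ _ (`|y| ^+ e.+1)); first by rewrite ler_wiXn2l.
rewrite exprS -(ler_pM2l c0) mulrCA.
apply: (@le_trans _ _ (k%:R^-1 * (B * t))).
  by rewrite ler_pM// mulr_ge0// ?exprn_ge0// ltW.
by rewrite mulrA ler_wpM2r ?(ltW t0)// mulrC ler_pdivrMr.
Qed.

(** * Projections of semi-algebraic sets to the plane *)

Module ord := ordered_qelim.ord.

(** The variable of index [0], called [t], is the inner one of
    [{poly {poly R}}], and the variable of index [1], called [y], the outer one,
    so that the value at [(t, y)] is [P.[y, t]].  The values at the other
    variables and at [GRing.Inv] are dummies. *)
Fixpoint term_poly (R : comNzRingType) (u : GRing.term R) : {poly {poly R}} :=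
  match u with
  | GRing.Var 0 => 'X%:P
  | GRing.Var 1 => 'X
  | GRing.Var _ => 0
  | GRing.Const a => a%:P%:P
  | GRing.NatConst k => k%:R
  | GRing.Add u1 u2 => term_poly u1 + term_poly u2
  | GRing.Opp u1 => - term_poly u1
  | GRing.NatMul u1 k => term_poly u1 *+ k
  | GRing.Mul u1 u2 => term_poly u1 * term_poly u2
  | GRing.Inv _ => 0
  | GRing.Exp u1 k => term_poly u1 ^+ k
  end.

Lemma term_polyE (R : comUnitRingType) (u : GRing.term R) (t y : R) :
  GRing.rterm u -> (term_poly u).[y, t] = GRing.eval [:: t; y] u.
Proof.
elim: u => //=.
- by move=> [|[|k]] _ /=; rewrite ?nth_nil !hornerE.
- by move=> a _; rewrite !hornerE.
- by move=> k _; rewrite -polyC_natr -polyC_natr !hornerE.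
- by move=> u1 IH1 u2 IH2 /andP[/IH1 <- /IH2 <-]; rewrite !hornerE.
- by move=> u1 IH1 /IH1 <-; rewrite !hornerE.
- by move=> u1 IH1 k /IH1 <-; rewrite !hornerMn.
- by move=> u1 IH1 u2 IH2 /andP[/IH1 <- /IH2 <-]; rewrite !hornerE.
- by move=> u1 IH1 k /IH1 <-; rewrite !hornerE.
Qed.

Fixpoint atom_polys (R : comNzRingType) (F : ord.formula R) : seq {poly {poly R}} :=
  match F with
  | ord.Equal u v | ord.Lt u v | ord.Le u v => [:: term_poly u - term_poly v]
  | ord.And F1 F2 | ord.Or F1 F2 | ord.Implies F1 F2 =>
      atom_polys F1 ++ atom_polys F2
  | ord.Not F1 => atom_polys F1
  | _ => [::]
  end.

Definition same_signs (R : realDomainType) (L : seq {poly {poly R}}) (t y y' : R) :=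
  forall P, P \in L -> Num.sg P.[y, t] = Num.sg P.[y', t].

Lemma qf_eval_same_signs (R : realFieldType) (F : ord.formula R) (t y y' : R) :
  ord.qf_form F && ord.rformula F -> same_signs (atom_polys F) t y y' ->
  ord.qf_eval [:: t; y] F = ord.qf_eval [:: t; y'] F.
Proof.
have bin (G : bool -> bool -> bool) F1 F2 :
  (ord.qf_form F1 && ord.rformula F1 -> same_signs (atom_polys F1) t y y' ->
    ord.qf_eval [:: t; y] F1 = ord.qf_eval [:: t; y'] F1) ->
  (ord.qf_form F2 && ord.rformula F2 -> same_signs (atom_polys F2) t y y' ->
    ord.qf_eval [:: t; y] F2 = ord.qf_eval [:: t; y'] F2) ->
  (ord.qf_form F1 && ord.qf_form F2) && (ord.rformula F1 && ord.rformula F2) ->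
  same_signs (atom_polys F1 ++ atom_polys F2) t y y' ->
  G (ord.qf_eval [:: t; y] F1) (ord.qf_eval [:: t; y] F2) =
  G (ord.qf_eval [:: t; y'] F1) (ord.qf_eval [:: t; y'] F2).
  move=> IH1 IH2 /andP[/andP[q1 q2] /andP[r1 r2]] sL.
  rewrite IH1 ?q1 ?r1// => [|P PL]; last by apply: sL; rewrite mem_cat PL.
  by rewrite IH2 ?q2 ?r2// => P PL; apply: sL; rewrite mem_cat PL orbT.
elim: F => //=.
- move=> u v /andP[ru rv] /(_ _ (mem_head _ _)).
  rewrite !hornerE !term_polyE// => sE.
  by rewrite -subr_eq0 -sgr_eq0 sE sgr_eq0 subr_eq0.
- move=> u v /andP[ru rv] /(_ _ (mem_head _ _)).
  rewrite !hornerE !term_polyE// => sE.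
  by rewrite -subr_lt0 -sgr_lt0 sE sgr_lt0 subr_lt0.
- move=> u v /andP[ru rv] /(_ _ (mem_head _ _)).
  rewrite !hornerE !term_polyE// => sE.
  by rewrite -subr_le0 -sgr_le0 sE sgr_le0 subr_le0.
- by move=> F1 IH1 F2 IH2; apply: bin.
- by move=> F1 IH1 F2 IH2; apply: bin.
- by move=> F1 IH1 F2 IH2; apply: (bin implb).
- by move=> F1 IH1 qF sL; rewrite IH1.
Qed.

(** This is quantifier elimination, keeping only what is needed of the
    quantifier-free formula: its truth depends on the signs of the finitely
    many polynomials that occur in it. *)
Lemma holds_same_signs (R : rcfType) (F : ord.formula R) : ord.rformula F ->
  exists L : seq {poly {poly R}}, forall t y y', same_signs L t y y' ->
    ord.holds [:: t; y] F -> ord.holds [:: t; y'] F.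
Proof.
move=> rF.
have wfP := ord.quantifier_elim_wf (@qe_rcf.wf_QE_wproj R) rF.
have qeP e := ord.quantifier_elim_rformP (@qe_rcf.wf_QE_wproj R)
  (@qe_rcf.valid_QE_wproj R) e rF.
move: (ord.quantifier_elim _ F) wfP qeP => Q wfP qeP.
exists (atom_polys Q) => t y y' sL /qeP Fy; apply/qeP.
by rewrite -(qf_eval_same_signs wfP sL).
Qed.

Definition exists_block (R : Type) (i m : nat) (F : ord.formula R) :=
  foldr (@ord.Exists R) F (iota i m).

(** Binding the variables just past the end of the environment turns a block of
    quantifiers into one quantification over the sequence to be appended. *)
Lemma holds_exists_block (R : realDomainType) (m : nat) (e : seq R) (F : ord.formula R) :
  ord.holds e (exists_block (size e) m F) <->
  exists2 v : seq R, size v = m & ord.holds (e ++ v) F.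
Proof.
elim: m e => [|m IH] e.
  split=> [eF|[v /size0nil ->]]; last by rewrite cats0.
  by exists [::]; rewrite ?cats0.
rewrite /exists_block /=.
have sE x : set_nth 0 e (size e) x = rcons e x.
  by rewrite set_nthE ltnn subnn cats1.
split=> [[x]|[[//|x v] [vm]]].
  rewrite sE -(size_rcons e x) => /IH[v <- ?].
  by exists (x :: v) => //; rewrite -cat_rcons.
rewrite -cat_rcons => eF; exists x; rewrite sE -(size_rcons e x).
by apply/IH; exists v.
Qed.

Lemma rformula_exists_block (R : realDomainType) (i m : nat) (F : ord.formula R) :
  ord.rformula (exists_block i m F) = ord.rformula F.
Proof. by rewrite /exists_block; elim: m i => //= m IH i; rewrite IH. Qed.

Definition mpoly_term (R : nzRingType) (n : nat) (tv : 'I_n -> GRing.term R)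
    (p : mpoly n R) : GRing.term R :=
  \big[@GRing.Add R/GRing.NatConst R 0]_(m <- msupp p)
    GRing.Mul (GRing.Const (mcoeff m p))
      (\big[@GRing.Mul R/GRing.NatConst R 1]_i GRing.Exp (tv i) (m i)).

Lemma eval_mpoly_term (R : comUnitRingType) n (tv : 'I_n -> GRing.term R) p e :
  GRing.eval e (mpoly_term tv p) = meval (fun i => GRing.eval e (tv i)) p.
Proof.
rewrite mevalE (big_morph (GRing.eval e) (id1 := 0) (op1 := +%R))//.
apply: eq_bigr => m _ /=; congr (_ * _).
by rewrite (big_morph (GRing.eval e) (id1 := 1) (op1 := *%R)).
Qed.

Lemma rterm_mpoly_term (R : comUnitRingType) n (tv : 'I_n -> GRing.term R) p :
  (forall i, GRing.rterm (tv i)) -> GRing.rterm (mpoly_term tv p).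
Proof.
move=> rtv; apply: (big_ind (@GRing.rterm R)) => //= [u v -> -> //|m _].
by apply: (big_ind (@GRing.rterm R)) => //= u v -> ->.
Qed.

(** The coordinates are given by arbitrary terms [tv], so that the graphs of two
    functions can share the variables of their common argument. *)
Lemma semialgebraic_formula (R : realType) n (A : set 'rV[R]_n)
    (tv : 'I_n -> GRing.term R) :
  (forall i, GRing.rterm (tv i)) -> semialgebraic A ->
  exists2 F : ord.formula R, ord.rformula F &
    forall e, ord.holds e F <-> A (\row_i GRing.eval e (tv i)).
Proof.
move=> rtv [s ->].
pose val e (p : mpoly n R) := meval ((\row_i GRing.eval e (tv i)) 0) p.
have valE e p : GRing.eval e (mpoly_term tv p) = val e p.
  rewrite eval_mpoly_term /val; apply: meval_eq => i; by rewrite mxE.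
have rT p : GRing.rterm (mpoly_term tv p) by exact: rterm_mpoly_term.
have conj (G : mpoly n R -> ord.formula R) (u : seq (mpoly n R)) :
    (forall p, ord.rformula (G p)) ->
    exists2 F, ord.rformula F &
      forall e, ord.holds e F <-> forall p, p \in u -> ord.holds e (G p).
  move=> rG; elim: u => [|p u [F rF FE]]; first by exists (ord.Bool true).
  exists (ord.And (G p) F) => [|e] /=; first by rewrite rG.
  split=> [[Gp /FE Gu] q|Gu]; first by rewrite inE => /orP[/eqP->|/Gu].
  split; first by apply: Gu; rewrite mem_head.
  by apply/FE => q qu; apply: Gu; rewrite inE qu orbT.
elim: s => [|[E I] s [F rF FE]].
  by exists (ord.Bool false) => // e; split=> // -[].
have [|FE' rE eE] := conj (fun p => ord.Equal (mpoly_term tv p) (GRing.NatConst R 0)) E.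
  by move=> p /=; rewrite rT.
have [|FI rI eI] := conj (fun p => ord.Lt (GRing.NatConst R 0) (mpoly_term tv p)) I.
  by move=> p /=; rewrite rT.
exists (ord.Or (ord.And FE' FI) F) => [|e] /=; first by rewrite rE rI.
split=> [[[/eE hE /eI hI]|/FE[B /= Bs Be]]|[B /=]].
- exists (E, I); rewrite /= ?mem_head//; split=> p pE.
    by have := hE _ pE; rewrite /= valE.
  by have := hI _ pE; rewrite /= valE.
- by exists B => //=; rewrite inE Bs orbT.
rewrite inE => /orP[/eqP->/= [hE hI]|Bs Be].
  left; split; [apply/eE => p pE|apply/eI => p pI]; rewrite /= valE.
    exact: hE.
  exact: hI.
by right; apply/FE; exists B.
Qed.

(** The formula uses the variables [t, y, psi x, f x, x_0, ..., x_(n-1)], in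
    this order, and binds all but the first two. *)
Lemma sublevel_formula (R : realType) n (f : 'rV[R]_n -> \bar R)
    (psi : 'rV[R]_n -> R) (a : R) :
  (forall x, f x != -oo%E) -> semialgebraic_fun f ->
  semialgebraic_fun (fun x => (psi x)%:E) ->
  exists2 F : ord.formula R, ord.rformula F &
    forall t y, ord.holds [:: t; y] F <->
      exists2 x, psi x <= t & (f x <= (a - y)%:E)%E.
Proof.
move=> fNy sf spsi.
pose tv (j : nat) (i : 'I_(n + 1)) : GRing.term R :=
  match fintype.split i with inl i' => GRing.Var R (4 + i') | inr _ => GRing.Var R j end.
have rtv j i : GRing.rterm (tv j i) by rewrite /tv; case: fintype.split.
have [Ff rf hf] := semialgebraic_formula (rtv 3%N) sf.
have [Fp rp hp] := semialgebraic_formula (rtv 2%N) spsi.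
have tvE j e : let z := \row_i GRing.eval e (tv j i) in
    rsubmx z 0 0 = e`_j /\ lsubmx z = \row_(i < n) e`_(4 + i).
  split; last apply/rowP => i; rewrite !mxE /tv.
    by rewrite -[rshift n 0]/(unsplit (inr 0)) unsplitK.
  by rewrite -[lshift 1 i]/(unsplit (inl i)) unsplitK.
pose F := ord.And Fp (ord.And Ff
  (ord.And (ord.Le (GRing.Var R 2) (GRing.Var R 0))
           (ord.Le (GRing.Add (GRing.Var R 3) (GRing.Var R 1)) (GRing.Const a)))).
exists (exists_block 2 n.+2 F); first by rewrite rformula_exists_block /= rp rf.
move=> t y; rewrite -[2%N]/(size [:: t; y]) holds_exists_block.
split=> [[v vn] [/hp + [/hf + [/= st yv]]]|[x xt fx]].
  rewrite /mkset; have [-> ->] := tvE 2%N ([:: t; y] ++ v).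
  have [-> ->] := tvE 3%N ([:: t; y] ++ v).
  set x := \row_i _ => /= -[psE] fE; exists x; first by rewrite -psE.
  by rewrite -fE lee_fin lerBrDr.
have ffin : f x \is a fin_num.
  by rewrite fin_numE fNy -ltey (le_lt_trans fx)// ltry.
pose e := [:: t; y] ++ psi x :: fine (f x) :: [seq x 0 i | i <- enum 'I_n].
have xE : \row_(i < n) e`_(4 + i) = x.
  by apply/rowP => i; rewrite mxE /e /= add0n (nth_map i) ?nth_ord_enum ?size_enum_ord.
exists (psi x :: fine (f x) :: [seq x 0 i | i <- enum 'I_n]).
  by rewrite /= size_map size_enum_ord.
split; first by apply/hp; rewrite /mkset; have [-> ->] := tvE 2%N e; rewrite xE.
split; first by apply/hf; rewrite /mkset; have [-> ->] := tvE 3%N e; rewrite xE /= fineK.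
by split=> //=; rewrite -lerBrDr -lee_fin fineK.
Qed.

(** * Growth of the supremum of a semi-algebraic family of sets of reals *)

(** A polynomial in [y] that does not vanish at [g] has constant sign near [g];
    one that vanishes identically raises no obstacle. *)
Lemma same_signs_near (R : rcfType) (L : seq {poly {poly R}}) (t g : R) :
  (forall P, P \in L -> P.[g, t] = 0 -> map_poly (horner_eval t) P = 0) ->
  exists2 d : R, 0 < d & forall y, `|y - g| < d -> same_signs L t g y.
Proof.
elim: L => [|P L IH] LP; first by exists 1.
have [|d d0 Hd] := IH; first by move=> Q QL; apply: LP; rewrite inE QL orbT.
have [d' d'0 Hd'] : exists2 d' : R, 0 < d' &
    forall y, `|y - g| < d' -> Num.sg P.[g, t] = Num.sg P.[y, t].
  have [Pg|Pg] := eqVneq P.[g, t] 0.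
    exists 1 => // y _; rewrite Pg horner2E.
    by rewrite (LP _ (mem_head _ _) Pg) horner0.
  have Pg0 : 0 < `|P.[g, t]| by rewrite normr_gt0.
  have [d' d'0 Hd'] := polyrcf.poly_cont g (map_poly (horner_eval t) P) Pg0.
  exists d' => // y /Hd'; rewrite -!horner2E ltr_distl.
  by case: (sgrP P.[g, t]) Pg => // s _; case: sgrP => //; lra.
exists (Num.min d d'); first by rewrite lt_min d0.
move=> y; rewrite lt_min => /andP[yd yd'] Q; rewrite inE => /orP[/eqP->|QL].
  exact: Hd'.
exact: Hd.
Qed.

(** Otherwise membership in [D] would be constant on a neighbourhood of
    [sup D], which contains points of [D] and points above [sup D]. *)
Lemma sup_root (R : realType) (L : seq {poly {poly R}}) (t : R) (D : set R) :
  has_sup D -> (forall y y', same_signs L t y y' -> D y -> D y') ->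
  exists2 P, P \in L & map_poly (horner_eval t) P != 0 /\ P.[sup D, t] = 0.
Proof.
move=> supD DL; apply: contrapT => nP.
have [P PL Pg|d d0 Hd] := @same_signs_near R L t (sup D).
  by apply/eqP; apply: contra_notT nP => P0; exists P.
have [y Dy yd] := sup_adherent d0 supD.
have yg : y <= sup D by apply: ub_le_sup => //; case: supD.
have Dg : D (sup D + d / 2).
  apply: DL Dy => P PL; rewrite -(Hd y)//; last by rewrite distrC ger0_norm; lra.
  by apply: Hd => //; rewrite addrC addKr gtr0_norm; lra.
have : sup D + d / 2 <= sup D by apply: ub_le_sup => //; case: supD.
lra.
Qed.

Lemma uniform_threshold (T : eqType) (L : seq T) (Q : T -> nat -> Prop) :
  (forall P, P \in L -> exists K, forall k, (K <= k)%N -> Q P k) ->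
  exists K, forall k, (K <= k)%N -> forall P, P \in L -> Q P k.
Proof.
elim: L => [|P L IH] LQ; first by exists 0%N.
have [K1 H1] := LQ _ (mem_head _ _).
have [|K2 H2] := IH; first by move=> P' P'L; apply: LQ; rewrite inE P'L orbT.
exists (maxn K1 K2) => k; rewrite geq_max => /andP[k1 k2] P'.
by rewrite inE => /orP[/eqP->|]; [exact: H1|exact: H2].
Qed.

Lemma sup_section_growth (R : realType) (L : seq {poly {poly R}}) (D : R -> set R) :
  (forall t y y', same_signs L t y y' -> D t y -> D t y') ->
  exists K : nat, forall k, (K <= k)%N -> forall t, has_sup (D t) ->
    (k%:R <= t -> `|sup (D t)| <= t ^+ k) /\
    (0 < t <= k%:R^-1 -> `|sup (D t)| <= k%:R^-1 -> `|sup (D t)| ^+ k <= t).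
Proof.
move=> DL.
pose Q (P : {poly {poly R}}) (k : nat) := P != 0 -> forall t y, P.[y, t] = 0 ->
  (k%:R <= t -> `|y| <= t ^+ k) /\
  (0 < t <= k%:R^-1 -> `|y| <= k%:R^-1 -> `|y| ^+ k <= t).
have [P _|K HK] := @uniform_threshold _ L Q.
  have [->|P0] := eqVneq P 0; first by exists 0%N => k _; rewrite /Q eqxx.
  have [K1 H1] := root_growth P0.
  (* In [root_decay] the outer variable is [t], in [root_growth] it is [y]. *)
  have [|K2 H2] := @root_decay _ (swapXY P); first by rewrite swapXY_eq0.
  exists (maxn K1 K2) => k; rewrite geq_max => /andP[k1 k2] _ t y Py.
  by split=> *; [exact: (H1 k)|apply: (H2 k); rewrite ?horner2_swapXY].
exists K => k Kk t supD; have [P PL [Pt0 Pt]] := sup_root supD (@DL t).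
apply: (HK k Kk P PL) Pt; apply: contraNneq Pt0 => ->.
by rewrite map_poly0.
Qed.

(** * Penalties and error bounds *)

Lemma penalty_ge0 (R : realType) (T : Type) (psi : T -> R) (alpha beta : R) x :
  0 <= penalty psi alpha beta x.
Proof. by rewrite addr_ge0 ?powR_ge0. Qed.

(** Three regimes are bounded separately: [psi x <= t0] by [root_decay],
    [psi x >= k] by [root_growth], and the range between them by the bound [M]
    on the gap, spread over [psi x `^ alpha >= t0 `^ alpha]. *)
Lemma semialgebraic_error_bound (R : realType) n (f : 'rV[R]_n -> \bar R)
    (psi : 'rV[R]_n -> R) (a : R) :
  (forall x, 0 <= psi x) -> (forall x, f x != -oo%E) -> semialgebraic_fun f ->
  semialgebraic_fun (fun x => (psi x)%:E) ->
  (forall e, 0 < e -> exists2 d, 0 < d &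
     forall x, psi x <= d -> ((a - e)%:E <= f x)%E) ->
  (forall T, exists M, forall x, psi x <= T -> ((a - M)%:E <= f x)%E) ->
  exists c alpha beta, admissible c alpha beta /\
    forall x, (a%:E <= penalized f psi alpha beta c x)%E.
Proof.
move=> psi0 fNy sf spsi near0 bnd.
pose D t := [set y | exists2 x, psi x <= t & (f x <= (a - y)%:E)%E].
have [F rF FE] := sublevel_formula a fNy sf spsi.
have [L HL] := holds_same_signs rF.
have [K HK] : exists K : nat, forall k, (K <= k)%N -> forall t, has_sup (D t) ->
    (k%:R <= t -> `|sup (D t)| <= t ^+ k) /\
    (0 < t <= k%:R^-1 -> `|sup (D t)| <= k%:R^-1 -> `|sup (D t)| ^+ k <= t).
  by apply: (@sup_section_growth _ L) => t y y' s /FE/(HL _ _ _ s)/FE.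
(* The successor keeps [k] positive, so that [alpha = 1 / k] is admissible. *)
pose k := K.+1; have {}HK := HK k (leqnSn K).
have k0 : 0 < k%:R :> R by rewrite ltr0n.
have k1 : 1 <= k%:R :> R by rewrite ler1n.
have [|d d0 Hd] := near0 k%:R^-1; first by rewrite invr_gt0.
have [M HM] := bnd k%:R.
pose t0 := Num.min d k%:R^-1.
have t00 : 0 < t0 by rewrite lt_min d0 invr_gt0.
pose alpha : R := k%:R^-1; pose B := Num.max M 0 / t0 `^ alpha.
have al0 : 0 < alpha by rewrite invr_gt0.
have B0 : 0 <= B by rewrite divr_ge0 ?powR_ge0// le_max lexx orbT.
exists (1 + B), alpha, k%:R; split.
  by split => //; [rewrite ltr_pwDl|rewrite invf_le1// k1].
move=> x; rewrite /penalized; set p := penalty _ _ _ _.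
have p0 : 0 <= p by exact: penalty_ge0.
have cp0 : 0 <= (1 + B) * p by rewrite mulr_ge0// addr_ge0.
case fx : (f x) (fNy x) => [r| |]// _; last by rewrite leey.
rewrite lee_fin; pose y := a - r.
suff : y <= (1 + B) * p by rewrite /y; lra.
have [y0|y0] := leP y 0; first exact: le_trans cp0.
have t_gt0 : 0 < psi x.
  rewrite lt_neqAle psi0 andbT eq_sym; apply/eqP => px0.
  have [|d' d'0 /(_ x)] := near0 (y / 2); first by rewrite divr_gt0.
  by rewrite px0 fx lee_fin ltW// => /(_ isT); move: y0; rewrite /y; lra.
set t := psi x in t_gt0.
have Dy : D t y by exists x; rewrite // fx /y subKr.
have ubD T M' : (forall x', psi x' <= T -> ((a - M')%:E <= f x')%E) ->
    ubound (D T) M'.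
  move=> H z [x' /H h1 h2]; have := le_trans h1 h2; rewrite lee_fin; lra.
have supD : has_sup (D t).
  by split; [exists y|have [M' HM'] := bnd t; exists M'; exact: ubD].
have yg : y <= sup (D t) by apply: ub_le_sup => //; case: supD.
have g0 : 0 < sup (D t) by exact: lt_le_trans yg.
have [] := HK t supD; rewrite gtr0_norm// => far close.
have tal : 0 <= t `^ alpha by exact: powR_ge0.
have tbe : 0 <= t `^ k%:R by exact: powR_ge0.
have pE : p = t `^ alpha + t `^ k%:R by [].
have pBp : p <= (1 + B) * p by rewrite mulrDl mul1r lerDl mulr_ge0.
have [kt|tk] := leP k%:R t.
  apply: (le_trans yg); apply: le_trans pBp; apply: (le_trans (far kt)).
  by rewrite pE -powR_mulrn ?(ltW t_gt0)// lerDr.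
have [tt0|t0t] := leP t t0.
  apply: (le_trans yg); apply: le_trans pBp; rewrite pE.
  move: tt0; rewrite le_min => /andP[td tkV].
  have gk : sup (D t) <= k%:R^-1.
    apply: ge_sup; first by exists y.
    by apply: ubD => x' /le_trans-/(_ _ td)/Hd.
  apply: (@le_trans _ _ (t `^ alpha)); last by rewrite lerDl.
  rewrite leNgt; apply/negP => tg.
  have /lt_le_trans : (t `^ alpha) ^+ k < sup (D t) ^+ k.
    by rewrite ltrXn2r// ?nnegrE// ltW.
  move=> /(_ _ (close _ gk)); rewrite t_gt0 => /(_ tkV).
  by rewrite -powR_mulrn// -powRrM mulVf ?gt_eqF// powRr1 ?ltxx// ltW.
have yM : y <= Num.max M 0.
  by rewrite le_max (ubD _ _ HM)//; exists x; rewrite ?fx /y ?subKr// ltW.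
apply: (le_trans yM); rewrite -[X in X <= _](divfK (lt0r_neq0 (powR_gt0 alpha t00))).
rewrite -/B (@le_trans _ _ (B * t `^ alpha))//.
  by rewrite ler_wpM2l// ge0_ler_powR ?nnegrE// ltW.
rewrite (@le_trans _ _ (B * p))//; first by rewrite ler_wpM2l// pE lerDl.
by rewrite mulrDl mul1r lerDr.
Qed.

(** * From error bounds to sequences, minimizers and exactness *)

Lemma cvg_powR_to0 (R : realType) (u : nat -> R) (a : R) : 0 < a ->
  (forall k, 0 <= u k) -> u k @[k --> \oo] --> 0 ->
  u k `^ a @[k --> \oo] --> 0.
Proof.
move=> a0 u0 cu; apply/cvgrPdist_lt => e e0.
have ea0 : 0 < e `^ a^-1 by exact: powR_gt0.
near=> k; have uk : u k < e `^ a^-1 by near: k; exact: (cvgr_lt 0 cu).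
rewrite sub0r normrN ger0_norm ?powR_ge0//.
have := gt0_ltr_powR a0 _ _ uk; rewrite !nnegrE u0 ltW// => /(_ isT isT).
by rewrite -powRrM mulVf ?gt_eqF// powRr1// ltW.
Unshelve. all: end_near.
Qed.

Section Elementary.
Variables (R : realType) (n : nat) (S : set 'rV[R]_n) (f : 'rV[R]_n -> \bar R)
  (psi : 'rV[R]_n -> R).
Hypotheses (fNy : forall x, f x != -oo%E)
  (fstar_fin : inf_on S f \is a fin_num) (psi_res : residual_function S psi).

Lemma penalty_eq0 alpha beta x : 0 < alpha -> 0 < beta ->
  (penalty psi alpha beta x = 0) <-> S x.
Proof.
move=> a0 b0; rewrite -(psi_res.2 x); split=> [/eqP|psx]; last first.
  by rewrite /penalty psx !powR0 ?gt_eqF// addr0.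
by rewrite paddr_eq0 ?powR_ge0// => /andP[/eqP/powR_eq0_eq0].
Qed.

(** This removes the truncation and the subtraction, which is where infinite
    values of [f] would need separate treatment. *)
Lemma pos_gap_le a x r : 0 <= r ->
  (pos_gap a%:E f x <= r%:E)%E = (a%:E <= f x + r%:E)%E.
Proof.
move=> r0; rewrite /pos_gap; case: (f x) (fNy x) => [s| |]// _.
  by rewrite -EFinB -EFinD -EFin_max !lee_fin ge_max r0 andbT lerBlDl.
by rewrite addye// leey ge_max leNye lee_fin r0.
Qed.

Lemma global_error_boundP c alpha beta : 0 <= c ->
  global_error_bound S f psi c alpha beta <->
  forall x, (inf_on S f <= penalized f psi alpha beta c x)%E.
Proof.
move=> c0; have gE x : (pos_gap (inf_on S f) f x <=
    (c * penalty psi alpha beta x)%:E)%E =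
    (inf_on S f <= penalized f psi alpha beta c x)%E.
  by rewrite -(fineK fstar_fin) pos_gap_le// mulr_ge0// penalty_ge0.
by split=> H x; move: (H x); rewrite gE.
Qed.

(** The same constants serve on both sides: exactness for all [c' > c] passes to
    the limit [c' -> c]. *)
Lemma exact_penalty_error_bound c alpha beta : admissible c alpha beta ->
  exact_penalty S f psi c alpha beta <-> global_error_bound S f psi c alpha beta.
Proof.
move=> [c0 a0 b0 _]; rewrite (global_error_boundP _ _ (ltW c0)).
split=> [ex x|eb c' cc'].
  have exx c' : c < c' -> (inf_on S f <= penalized f psi alpha beta c' x)%E.
    by move=> cc'; rewrite (ex _ cc'); apply: ereal_inf_lbound; exists x.
  move: exx; rewrite /penalized -(fineK fstar_fin).
  case: (f x) (fNy x) => [r| |]// _ exx; last by rewrite addye// leey.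
  rewrite -EFinD lee_fin; set p := penalty _ _ _ _ in exx *.
  have p0 : 0 <= p by exact: penalty_ge0.
  apply/ler_addgt0Pr => e e0.
  have p1 : 0 < p + 1 by rewrite ltr_wpDl.
  (* [p] may vanish, hence [p + 1]. *)
  have := exx (c + e / (p + 1)); rewrite -EFinD lee_fin ltrDl divr_gt0// => /(_ isT).
  move=> /le_trans; apply; rewrite -[leRHS]addrA.
  rewrite lerD2l mulrDl lerD2l.
  by rewrite mulrAC ler_pdivrMr// ler_pM2l// lerDl.
apply/eqP; rewrite eq_le; apply/andP; split.
  apply/ereal_infP => _ [x _ <-]; apply: le_trans (eb x) _.
  by rewrite leeD2l// lee_fin ler_wpM2r ?penalty_ge0// ltW.
apply/ereal_infP => _ [x Sx <-]; apply: ereal_inf_lbound; exists x => //.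
by rewrite /penalized (penalty_eq0 x a0 b0).2// mulr0 adde0.
Qed.

(** At a minimizer of the penalized function with a positive penalty, lowering
    the coefficient from [c'] to [c] would violate the error bound. *)
Lemma argmin_penalized c alpha beta : admissible c alpha beta ->
  global_error_bound S f psi c alpha beta -> forall c', c < c' ->
  argmin S f = argmin setT (penalized f psi alpha beta c').
Proof.
move=> adm eb c' cc'; have [c0 a0 b0 _] := adm.
have ex := (exact_penalty_error_bound adm).2 eb c' cc'.
move: eb => /(global_error_boundP _ _ (ltW c0)) eb.
have penE x : S x -> penalized f psi alpha beta c' x = f x.
  by move=> Sx; rewrite /penalized (penalty_eq0 x a0 b0).2// mulr0 adde0.
apply/seteqP; split=> x [].
  by move=> Sx _ fx; split; rewrite // -ex// penE.
move=> _ _ xmin; have Sx : S x; last by split; rewrite // -penE// xmin.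
apply/(penalty_eq0 x a0 b0); apply/eqP.
rewrite eq_le penalty_ge0 andbT leNgt; apply/negP => p0.
have := eb x; rewrite ex -xmin /penalized.
have : penalized f psi alpha beta c' x \is a fin_num by rewrite xmin -ex.
rewrite /penalized; case: (f x) => [r| |]// _.
by rewrite -!EFinD lee_fin lerD2l ler_pM2r// leNgt cc'.
Qed.

Lemma error_bound_sequential c alpha beta : admissible c alpha beta ->
  global_error_bound S f psi c alpha beta -> sequential_condition S f psi.
Proof.
move=> [c0 a0 b0 _] eb x; split=> [psi0|fNyx].
  have pen0 : c * penalty psi alpha beta (x k) @[k --> \oo] --> 0.
    rewrite -[X in _ --> X](mulr0 c) -[X in _ --> c * X](addr0 0).
    apply: cvgM; first exact: cvg_cst.
    by apply: cvgD; apply: cvg_powR_to0 => // k; exact: psi_res.1.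
  apply: (@squeeze_cvge _ _ _ _ (cst 0%E) _
    (fun k => (c * penalty psi alpha beta (x k))%:E)).
  - by apply: nearW => k; rewrite eb /pos_gap le_max lexx orbT.
  - exact: cvg_cst.
  - by apply/fine_cvgP; split; [apply: nearW => k|exact: pen0].
apply/cvgryPgt => A; pose A' := Num.max A 0.
pose M := c * (A' `^ alpha + A' `^ beta).
have {}fNyx := (cvgeNyPle _).1 fNyx (fine (inf_on S f) - M - 1).
near=> k; rewrite ltNge; apply/negP => psA.
have psA' : psi (x k) <= A' by rewrite le_max psA.
have A'0 : 0 <= A' by rewrite le_max lexx orbT.
have := (global_error_boundP _ _ (ltW c0)).1 eb (x k).
rewrite -(fineK fstar_fin) /penalized.
(* The slack 1 makes the contradiction strict. *)
have : (f (x k) <= (fine (inf_on S f) - M - 1)%:E)%E.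
  by near: k; exact: fNyx.
case: (f (x k)) (fNy (x k)) => [r| |]// _.
rewrite -EFinD !lee_fin.
suff : c * penalty psi alpha beta (x k) <= M by lra.
by rewrite ler_pM2l// lerD// ge0_ler_powR ?nnegrE ?(ltW a0) ?(ltW b0)// psi_res.1.
Unshelve. all: end_near.
Qed.

(** Part (iii1) restated without sequences: a failure of the conclusion gives
    points with [psi] tending to [0] and gap at least [e]. *)
Lemma sequential_local : sequential_condition S f psi ->
  forall e, 0 < e -> exists2 d, 0 < d &
    forall x, psi x <= d -> ((fine (inf_on S f) - e)%:E <= f x)%E.
Proof.
move=> seqc e e0; apply: contrapT => nd.
have /choice[x xP] : forall k : nat, exists x, psi x <= k.+1%:R^-1 /\
    (f x < (fine (inf_on S f) - e)%:E)%E.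
  move=> k; apply: contrapT => nx; apply: nd; exists k.+1%:R^-1.
    by rewrite invr_gt0 ltr0n.
  by move=> x px; rewrite leNgt; apply/negP => fx; apply: nx; exists x.
have [+ _] := seqc x.
have psx : psi (x k) @[k --> \oo] --> 0.
  apply: (@squeeze_cvgr _ _ _ _ (cst 0) harmonic).
  - by apply: nearW => k; rewrite psi_res.1 /= (xP k).1.
  - exact: cvg_cst.
  - exact: cvg_harmonic.
move=> /(_ psx)/fine_cvgP[_]/cvgr_lt-/(_ e e0) gap.
have [k] := filter_ex gap.
have [_] := xP k; rewrite /= /pos_gap -{2}(fineK fstar_fin).
case: (f (x k)) (fNy (x k)) => [r| |]// _.
rewrite lte_fin -EFinB -EFin_max /= => h; apply/negP; rewrite -leNgt le_max; lra.
Qed.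

(** Part (iii2) restated without sequences: a failure of the conclusion gives
    points with [psi] at most [t] along which [f] tends to [-oo]. *)
Lemma sequential_bounded : sequential_condition S f psi ->
  forall t, exists M, forall x, psi x <= t -> ((fine (inf_on S f) - M)%:E <= f x)%E.
Proof.
move=> seqc t; apply: contrapT => nM.
have /choice[x xP] : forall k : nat, exists x, psi x <= t /\
    (f x < (fine (inf_on S f) - k%:R)%:E)%E.
  move=> k; apply: contrapT => nx; apply: nM; exists k%:R.
  by move=> x px; rewrite leNgt; apply/negP => fx; apply: nx; exists x.
have [_] := seqc x.
have fx : f (x k) @[k --> \oo] --> -oo%E.
  apply/cvgeNyPle => A; near=> k.
  have [_ /ltW/le_trans] := xP k; apply; rewrite lee_fin.
  suff : fine (inf_on S f) - A <= k%:R by lra.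
  near: k; exact: nbhs_infty_ger.
move=> /(_ fx)/cvgryPgt-/(_ t) pt.
have [k] := filter_ex pt.
by rewrite ltNge (xP k).1.
Unshelve. all: end_near.
Qed.

End Elementary.

Theorem theorem5p3 (R : realType) (n : nat) (S : set 'rV[R]_n)
    (f : 'rV[R]_n -> \bar R) (psi : 'rV[R]_n -> R)
    (S_nonempty : S !=set0)
    (S_semialg : semialgebraic S)
    (f_proper : forall x, f x != -oo%E)
    (f_semialg : semialgebraic_fun f)
    (fstar_fin : inf_on S f \is a fin_num)
    (psi_residual : residual_function S psi)
    (psi_semialg : semialgebraic_fun (fun x => (psi x)%:E)) :
  let prop_i := exists cstar alpha beta : R,
    admissible cstar alpha beta /\
    exact_penalty S f psi cstar alpha beta in
  let prop_ii := exists cstar alpha beta : R,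
    admissible cstar alpha beta /\
    global_error_bound S f psi cstar alpha beta in
  let prop_iii := sequential_condition S f psi in
  [/\ prop_i <-> prop_ii,
      prop_ii <-> prop_iii
    & forall cstar alpha beta : R,
        admissible cstar alpha beta ->
        exact_penalty S f psi cstar alpha beta \/
        global_error_bound S f psi cstar alpha beta ->
        forall c : R, cstar < c ->
          argmin S f = argmin setT (penalized f psi alpha beta c)].
Proof.
move=> prop_i prop_ii prop_iii.
have exP c al be :=
  @exact_penalty_error_bound _ _ _ _ _ f_proper fstar_fin psi_residual c al be.
split.
- by split=> -[c [al [be [adm H]]]]; exists c, al, be; split=> //; apply/(exP _ _ _ adm).
- split=> [[c [al [be [adm H]]]]|seqc].
    exact: (error_bound_sequential f_proper fstar_fin psi_residual adm).
  have [c [al [be [adm H]]]] := semialgebraic_error_bound psi_residual.1 f_proper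
    f_semialg psi_semialg (sequential_local f_proper fstar_fin psi_residual seqc)
    (sequential_bounded seqc).
  exists c, al, be; split=> //; have [c0 _ _ _] := adm.
  apply/(global_error_boundP psi f_proper fstar_fin _ _ (ltW c0)) => x.
  by rewrite -(fineK fstar_fin).
- move=> c al be adm H; apply: (argmin_penalized f_proper fstar_fin psi_residual adm).
  by case: H => // /(exP _ _ _ adm).
Qed.
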